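(* Let $k\geq2$ and let $d_1=1$, $d_2\geq2,\dots,d_k\geq2$ be integers. Then the smallest eigenvalue of $L(B(d_1,\dots,d_k))$ is the smallest zero of the polynomial $g_{k-1}(\lambda)$, and it is not a zero of any of the polynomials \[ \frac{g_k(\lambda)}{\lambda+2},\; g_1(\lambda),\dots,g_{k-2}(\lambda). \] In particular, the multiplicity of the smallest eigenvalue of $L(B(d_1,\dots,d_k))$ is $d_k-1$.
   Context: All graphs are finite, undirected and simple; eigenvalues of a graph are those of its adjacency matrix. $L(G)$ denotes the line graph of $G$. For integers $d_1=1$, $d_2\geq2,\dots,d_{k-1}\geq2$, $d_k\geq1$ with $k\ge 2$, $B(d_1,\dots,d_k)$ is the generalized Bethe tree: the rooted tree with $k$ levels (the root being at level $1$) in which every vertex at level $j$ has degree $d_{k-j+1}$. Thus the root has degree $d_k$ and the leaves at level $k$ have degree $d_1=1$. The polynomials $g_i(\lambda)$ ($i=0,1,\dots,k$) associated with $(d_1,\dots,d_k)$ are defined by $g_0(\lambda)=1$, $g_1(\lambda)=\lambda+1$, \[ g_i(\lambda)=(\lambda+2-d_i)g_{i-1}(\lambda)-(d_i-1)g_{i-2}(\lambda)\quad(i=2,\dots,k-1), \] \[ g_k(\lambda)=(\lambda+2-d_k)g_{k-1}(\lambda)-d_k\,g_{k-2}(\lambda). \] The polynomial $g_k(\lambda)$ is divisible by $\lambda+2$, so $g_k(\lambda)/(\lambda+2)$ is a polynomial. For $k=2$ the list $g_1,\dots,g_{k-2}$ is empty. *)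

(* Defs.v *)
From HB Require Import structures.
From mathcomp Require Import all_boot all_order all_algebra.
From mathcomp Require Import ring.

Set Implicit Arguments.
Unset Strict Implicit.
Unset Printing Implicit Defensive.

Import Order.TTheory GRing.Theory Num.Theory.

Record sgraph := SGraph {
  vertex :> finType;
  adj : rel vertex;
  adj_sym : symmetric adj;
  adj_irrefl : irreflexive adj
}.

Section Graphs.
Variable G : sgraph.

Definition is_edge (E : {set G}) : bool :=
  [exists x : G, exists y : G, adj x y && (E == [set x; y])].

Definition degree (x : G) : nat := #|[set y : G | adj x y]|.

Definition connected : Prop := forall x y : G, connect (@adj G) x y.

(* [ucycle] also accepts the empty sequence and a single edge traversed back
   and forth; a cycle of a simple graph has at least three vertices. *)
Definition acyclic : Prop :=
  forall c : seq G, ucycle (@adj G) c -> (size c < 3)%N.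

Definition is_tree : Prop := [/\ (0 < #|G|)%N, connected & acyclic].

(* Least length of a walk from x to y; equal to #|G| when there is none. *)
Definition dist (x y : G) : nat :=
  find (fun n => [exists p : n.-tuple G, path (@adj G) x p && (last x p == y)])
       (iota 0 #|G|).

Definition level (r x : G) : nat := (dist r x).+1.

(* G, rooted at r, is B(d 1, ..., d k); the values of d outside 1..k play no
   role. *)
Definition is_bethe_tree (r : G) (k : nat) (d : nat -> nat) : Prop :=
  [/\ is_tree,
      forall x : G, (level r x <= k)%N,
      exists x : G, level r x = k
    & forall x : G, degree x = d (k - level r x + 1)%N].

Definition line_vertex : finType := {E : {set G} | is_edge E}.

Definition line_adj (E F : line_vertex) : bool :=
  (E != F) && (val E :&: val F != set0).

Lemma line_adj_sym : symmetric line_adj.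
Proof. by move=> E F; rewrite /line_adj eq_sym setIC. Qed.

Lemma line_adj_irrefl : irreflexive line_adj.
Proof. by move=> E; rewrite /line_adj eqxx. Qed.

Definition line_graph : sgraph := SGraph line_adj_sym line_adj_irrefl.

End Graphs.

Local Open Scope ring_scope.

Definition adjmx (R : rcfType) (G : sgraph) : 'M[R]_#|G| :=
  \matrix_(i, j) (adj (enum_val i) (enum_val j))%:R.

Definition smallest_eigenvalue (R : rcfType) (G : sgraph) (x : R) : Prop :=
  eigenvalue (adjmx R G) x /\ forall y, eigenvalue (adjmx R G) y -> x <= y.

(* Multiplicity as a zero of the characteristic polynomial (0 when x is not an
   eigenvalue); the matrix being symmetric, this is also the dimension of the
   eigenspace. *)
Definition eigenvalue_mult (R : rcfType) (G : sgraph) (x : R) : nat :=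
  mup x (char_poly (adjmx R G)).

Definition smallest_zero (R : rcfType) (p : {poly R}) (x : R) : Prop :=
  root p x /\ forall y, root p y -> x <= y.

(* g_i for 0 <= i <= k. The index k enters only through the last coefficient,
   which is d_k instead of d_k - 1 at i = k. *)
Fixpoint gpoly (R : rcfType) (k : nat) (d : nat -> nat) (i : nat) : {poly R} :=
  match i with
  | 0 => 1
  | 1 => 'X + 1
  | ((j.+1) as i1).+1 =>
      ('X + 2 - (d i)%:R) * gpoly R k d i1
      - (if i == k then (d i)%:R else (d i)%:R - 1) * gpoly R k d j
  end.

(* Hence the Euclidean quotient of g_k by 'X + 2 is exact. *)
Lemma dvdp_gpoly_last (R : rcfType) (k : nat) (d : nat -> nat) :
  (2 <= k)%N -> 'X + 2 %| gpoly R k d k.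
Proof.
have nat_eval n : (n%:R : {poly R}).[- 2] = n%:R.
  by rewrite -polyC_natr hornerC.
have gE j : (gpoly R k d j.+2).[- 2] = - (d j.+2)%:R * (gpoly R k d j.+1).[- 2]
    - (if j.+2 == k then (d j.+2)%:R else (d j.+2)%:R - 1) * (gpoly R k d j).[- 2].
  have -> : gpoly R k d j.+2 = ('X + 2 - (d j.+2)%:R) * gpoly R k d j.+1
      - (if j.+2 == k then (d j.+2)%:R else (d j.+2)%:R - 1) * gpoly R k d j by [].
  by case: ifP => _;
    rewrite !(nat_eval, hornerD, hornerN, hornerM, hornerX, hornerC); ring.
have sgnE n : ((n < k)%N -> (gpoly R k d n).[- 2] = (-1) ^+ n) /\
    ((n.+1 < k)%N -> (gpoly R k d n.+1).[- 2] = (-1) ^+ n.+1).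
  elim: n => [|n [IH1 IH2]].
    by split=> _; rewrite /= ?hornerD ?hornerX hornerC ?expr0 ?expr1 //; ring.
  split=> // nk; rewrite gE ltn_eqF // IH1 ?IH2 ?exprS; [ring | exact: ltnW |].
  exact/ltnW/ltnW.
case: k gE sgnE => [|[|m]] // gE sgnE _.
have -> : 'X + 2 = 'X - (- 2)%:P :> {poly R}.
  by rewrite rmorphN opprK /= polyC_natr.
rewrite dvdp_XsubCl; apply/rootP; rewrite gE eqxx.
by rewrite (sgnE m).2 // (sgnE m).1 // exprS; ring.
Qed.

(* Main.v *)
Require Import Defs.
From HB Require Import structures.
From mathcomp Require Import all_boot all_order all_algebra.
From mathcomp Require Import ring lra zify.

Set Implicit Arguments.
Unset Strict Implicit.
Unset Printing Implicit Defensive.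

Import Order.TTheory GRing.Theory Num.Theory.
Local Open Scope ring_scope.

(** Write [mu := lam + 2], let [A] be the adjacency matrix of the line graph and
    identify each edge of the tree with its endpoint farther from the root, so
    that a vector on the edges becomes a function [y] on the vertices with value
    0 at the root. Since [A + 2] is the Gram matrix of the incidence matrix
    ([line_graph_form]), the quadratic form of [A - lam] is
<<
      sum_v (y_v + sum of the y_c, c child of v)^2 - mu sum_v y_v^2
>>
    ([adjmx_tree_form]). Minimizing it from the leaves upwards, the edge above a
    vertex of height [j] together with everything below it contributes at least
    [a_j y_v^2], where [a_1 = 1 - mu] and
    [a_{j+1} = a_j / (a_j + d_{j+1} - 1) - mu], as long as the previous [a_i] are
    positive. Writing [a_j] as a fraction [rnum / rden] of polynomials in [mu],
    one finds that the numerator is [(-1)^j g_j] for [j < k] ([gpoly_rnum]).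

    The functions [a_j] decrease while they are positive ([rnum_cross]), so by
    the intermediate value theorem their first zeros decrease strictly with [j]
    ([first_zero]). Take for [lam] the smallest zero of [g_{k-1}]. There
    [a_j > 0] for [j < k - 1], so [g_1, ..., g_{k-2}] do not vanish, nor does
    [g_k], whose value is [- d_k g_{k-2}]. As moreover [a_{k-1} = 0], the form becomes a sum of
    squares ([tree_sos]): [A - lam] is positive semidefinite, and a vector in
    its kernel is determined by its values on the edges at the root, which are
    subject to the single condition that their sum is 0 ([tree_form_eq0]). Hence
    [lam] is the smallest eigenvalue and its eigenspace has dimension [d_k - 1].
    As [A] is symmetric, this is the multiplicity of [lam] as a zero of the
    characteristic polynomial ([mup_char_poly_sym]). *)

(** * The minimization ratios and the polynomials g_j *)

Section Ratio.
Variables (R : rcfType) (d : nat -> nat).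

(** The least value of the quadratic form of the line graph, shifted by
    [mu - 2], on an edge of value 1 together with the subtree hanging below its
    lower endpoint at height [j], is [p / q] with [(p, q) := ratio mu j], provided
    that the ratios at smaller heights are positive.
    Numerators and denominators are kept apart so that both stay polynomial in
    [mu]. With [d 1 = 1] the first step gives [(1 - mu, 1)] whatever the
    denominator at 0; the value 1 chosen there keeps every denominator positive
    in the relevant range. *)
Fixpoint ratio (mu : R) (j : nat) : R * R :=
  if j is i.+1 then
    let: (p, q) := ratio mu i in
    let q' := p + ((d j)%:R - 1) * q in (p - mu * q', q')
  else (1, 1).

Definition rnum mu j := (ratio mu j).1.
Definition rden mu j := (ratio mu j).2.

Lemma rdenS mu j :
  rden mu j.+1 = rnum mu j + ((d j.+1)%:R - 1) * rden mu j.
Proof. by rewrite /rden /rnum /=; case: (ratio mu j). Qed.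

Lemma rnumS mu j : rnum mu j.+1 = rnum mu j - mu * rden mu j.+1.
Proof. by rewrite /rden /rnum /=; case: (ratio mu j). Qed.

Hypothesis d1 : d 1 = 1%N.

Lemma rden1 mu : rden mu 1 = 1.
Proof. by rewrite rdenS d1 subrr mul0r addr0. Qed.

Lemma gpolySS k j : gpoly R k d j.+2 =
  ('X + 2 - (d j.+2)%:R) * gpoly R k d j.+1
  - (if j.+2 == k then (d j.+2)%:R else (d j.+2)%:R - 1) * gpoly R k d j.
Proof. by []. Qed.

Lemma horner_natr (n : nat) (x : R) : (n%:R : {poly R}).[x] = n%:R.
Proof. by rewrite -polyC_natr hornerC. Qed.

(** Eliminating the denominators from the two-term recursion leaves, up to
    sign, the three-term recursion of the [g_j]. At [j = k] the last coefficient
    of [g_k] differs, which is why [j < k]. *)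
Lemma gpoly_rnum k j lam : (j < k)%N ->
  (gpoly R k d j).[lam] = (-1) ^+ j * rnum (lam + 2) j.
Proof.
move=> jk; suff: forall i, (i <= j)%N ->
    (gpoly R k d i).[lam] = (-1) ^+ i * rnum (lam + 2) i by exact.
elim: j jk => [|j IH] jk i; first by rewrite leqn0 => /eqP->; rewrite hornerC mul1r.
rewrite leq_eqVlt => /predU1P[->|]; last exact/IH/ltnW.
case: j IH jk => [|j] IH jk.
  by rewrite rnumS rden1 /= hornerD hornerX hornerC /rnum /=; ring.
have jE := IH (ltnW jk) j (leqnSn j); have j1E := IH (ltnW jk) j.+1 (leqnn _).
rewrite gpolySS ltn_eqF // !(horner_natr, hornerD, hornerN, hornerM, hornerX, hornerC).
rewrite jE j1E (rnumS _ j.+1) (rdenS _ j.+1) (rnumS _ j) !exprS; ring.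
Qed.

Lemma rden_gt0 mu j : (forall i, (1 <= i <= j)%N -> (1 <= d i)%N) ->
  (forall i, (i < j)%N -> 0 < rnum mu i) ->
  forall i, (i <= j)%N -> 0 < rden mu i.
Proof.
move=> dj nj; elim=> [|i IH] ij; first exact: ltr01.
rewrite rdenS ltr_wpDr ?nj // mulr_ge0 ?(ltW (IH (ltnW ij))) //.
by rewrite subr_ge0 ler1n dj.
Qed.

(** The ratio decreases strictly in its parameter as long as it stays
    positive: the cross-difference of step [j + 1] is [d_{j+1} - 1] times that
    of step [j], plus the product of [mu - nu] with the two denominators. *)
Lemma rnum_cross mu nu j : (forall i, (1 <= i <= j.+1)%N -> (1 <= d i)%N) ->
  nu < mu -> (forall i, (i < j.+1)%N -> 0 < rnum mu i) ->
  (forall i, (i < j.+1)%N -> 0 < rnum nu i) ->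
  rnum mu j.+1 * rden nu j.+1 < rnum nu j.+1 * rden mu j.+1.
Proof.
move=> dj ltmu nmu nnu.
have dmu := rden_gt0 dj nmu; have dnu := rden_gt0 dj nnu.
suff: forall i, (i <= j.+1)%N ->
    rnum mu i * rden nu i <= rnum nu i * rden mu i /\
    ((0 < i)%N -> rnum mu i * rden nu i < rnum nu i * rden mu i).
  by move/(_ j.+1 (leqnn _))=> [_]; apply.
elim=> [|i IH] ij; first by rewrite mulrC.
suff lt_cross : rnum mu i.+1 * rden nu i.+1 < rnum nu i.+1 * rden mu i.+1.
  by split=> //; exact: ltW.
have [le_cross _] := IH (ltnW ij).
rewrite -subr_gt0 !rnumS.
have -> : (rnum nu i - nu * rden nu i.+1) * rden mu i.+1 -
    (rnum mu i - mu * rden mu i.+1) * rden nu i.+1 =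
    ((d i.+1)%:R - 1) * (rnum nu i * rden mu i - rnum mu i * rden nu i)
    + (mu - nu) * (rden nu i.+1 * rden mu i.+1).
  by rewrite !rdenS; ring.
rewrite ltr_wpDl ?mulr_ge0 ?subr_ge0 ?ler1n ?dj // ?mulr_gt0 ?subr_gt0 //.
- exact: dnu.
- exact: dmu.
Qed.

(** The smallest zeros decrease strictly with the index. If [m] is the first
    zero at index [j + 1], the next numerator is positive at 0 and negative at
    [m], hence vanishes in between, and monotonicity of the ratio excludes
    earlier zeros. Carrying positivity of all smaller indices up to the zero
    is what makes the induction work. *)
Lemma first_zero k j : (j.+1 < k)%N ->
  (forall i, (2 <= i < k)%N -> (2 <= d i)%N) ->
  exists mu : R, [/\ 0 < mu, rnum mu j.+1 = 0,
    forall i, (i < j.+1)%N -> 0 < rnum mu i &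
    forall (nu : R) i, nu < mu -> (i <= j.+1)%N -> 0 < rnum nu i].
Proof.
move=> jk d2; have dge1 i : (1 <= i < k)%N -> (1 <= d i)%N.
  case: i => [|[|i]] // ik; first by rewrite d1.
  exact/ltnW/d2.
elim: j jk => [|j IH] jk.
  have r1 x : rnum x 1 = 1 - x by rewrite rnumS rden1 mulr1.
  exists 1; split; first exact: ltr01.
  - by rewrite r1 subrr.
  - by case.
  - by move=> nu [|[|i]] // nu1 _; rewrite r1 subr_gt0.
have [m [m0 mz mpos mlow]] := IH (ltnW jk).
have low nu i : nu <= m -> (i < j.+1)%N -> 0 < rnum nu i.
  by rewrite le_eqVlt => /predU1P[-> /mpos|/mlow h /ltnW/h].
have lowz nu : nu <= m -> 0 <= rnum nu j.+1.
  by rewrite le_eqVlt => /predU1P[->|/mlow h]; [rewrite mz|exact/ltW/h].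
have d1j i : (1 <= i <= j.+1)%N -> (1 <= d i)%N.
  by move=> /andP[i0 ij]; apply: dge1; rewrite i0 (leq_ltn_trans ij) // ltnW.
have d1j2 i : (1 <= i <= j.+2)%N -> (1 <= d i)%N.
  by move=> /andP[i0 ij]; apply: dge1; rewrite i0 (leq_ltn_trans ij).
have den nu : nu <= m -> 0 < rden nu j.+2.
  move=> num; rewrite rdenS ltr_wpDl ?lowz // mulr_gt0 //.
    by rewrite subr_gt0 ltr1n d2.
  by apply: (rden_gt0 d1j) => // i; exact: low.
(* The sign turns rnum 0 > 0 >= rnum m into the increasing sign change that the
   intermediate value theorem asks for. *)
pose q := (-1) ^+ j.+3 *: gpoly R k d j.+2.
have qE x : q.[x] = - rnum (x + 2) j.+2.
  by rewrite hornerZ gpoly_rnum // exprS mulN1r mulNr signrMK.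
have [x /andP[x0 xm] /rootP qx] : exists2 x, - 2 <= x <= m - 2 & root q x.
  apply: poly_ivt; first by lra.
  rewrite !qE addNr subrK !(rnumS _ j.+1) mz sub0r mul0r subr0 opprK oppr_le0.
  by rewrite mulr_ge0 ?(ltW m0) ?(ltW (den _ _)) // ltW // mlow.
have xE : rnum (x + 2) j.+2 = 0 by apply/eqP; rewrite -oppr_eq0 -qE qx.
set mu := x + 2 in xE.
have mum : mu <= m by rewrite /mu; lra.
have mu0 : 0 <= mu by rewrite /mu; lra.
have n0 : 0 < rnum 0 j.+1 by apply: mlow.
have mu_gt0 : 0 < mu.
  rewrite lt_neqAle mu0 andbT eq_sym; apply/eqP=> e.
  by move: xE n0; rewrite e rnumS mul0r subr0 => ->; rewrite ltxx.
have mu_lt : mu < m.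
  rewrite lt_neqAle mum andbT; apply/eqP=> e.
  have := mulr_gt0 m0 (den m (lexx _)).
  by move: xE; rewrite e rnumS mz sub0r => /eqP; rewrite oppr_eq0 => /eqP->; rewrite ltxx.
exists mu; split=> // [i|nu i numu]; first by rewrite ltnS; apply: mlow.
have num : nu < m by exact: lt_trans mu_lt.
rewrite leq_eqVlt => /predU1P[->|]; last by rewrite ltnS; exact: mlow.
have := rnum_cross d1j2 numu (fun i => mlow mu i mu_lt) (fun i => mlow nu i num).
by rewrite xE mul0r pmulr_lgt0 // den.
Qed.

End Ratio.

(** * Symmetric matrices *)

Lemma dot_ge0 (R : realFieldType) n (u : 'rV[R]_n) : 0 <= (u *m u^T) 0 0.
Proof. by rewrite mxE sumr_ge0 // => i _; rewrite mxE -expr2 sqr_ge0. Qed.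

Lemma dot_eq0 (R : realFieldType) n (u : 'rV[R]_n) : (u *m u^T) 0 0 = 0 -> u = 0.
Proof.
rewrite mxE => /eqP; rewrite psumr_eq0 => [|i _]; last first.
  by rewrite mxE -expr2 sqr_ge0.
move=> /allP u0; apply/rowP=> i; rewrite mxE; apply/eqP.
by have := u0 i (mem_index_enum i); rewrite mxE mulf_eq0 orbb.
Qed.

(** Otherwise moving from [u] a little against [w := u *m S] would make the
    form negative, as its first variation there is [- 2 (w *m w^T)]. *)
Lemma psd_ker (R : realFieldType) n (S : 'M[R]_n) (u : 'rV_n) :
  S^T = S -> (forall v : 'rV_n, 0 <= (v *m S *m v^T) 0 0) ->
  (u *m S *m u^T) 0 0 = 0 -> u *m S = 0.
Proof.
move=> symS psd u0; apply: dot_eq0; set w := u *m S.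
set N := (w *m w^T) 0 0; set Q := (w *m S *m w^T) 0 0.
have Q0 : 0 <= Q by exact: psd.
have N0 : 0 <= N by exact: dot_ge0.
(* The form at u - t w is - 2 t N + t ^+ 2 Q. *)
have quad t : (((u - t *: w) *m S *m (u - t *: w)^T) 0 0) = t * (t * Q - 2 * N).
  have -> : (u - t *: w)^T = u^T - t *: w^T by rewrite linearB linearZ.
  have SuE : S *m u^T = w^T by rewrite /w trmx_mul symS.
  have wuE : w *m S *m u^T = w *m w^T by rewrite -mulmxA SuE.
  have entE (X Y Z W : 'M[R]_1) :
      (X - t *: Y - (t *: Z - t *: (t *: W))) 0 0 =
      X 0 0 - t * (Y 0 0 + Z 0 0) + t ^+ 2 * W 0 0.
    by rewrite !mxE; ring.
  rewrite !(mulmxBl, mulmxBr) -!(scalemxAl, scalemxAr) wuE entE -/w -/N -/Q u0.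
  ring.
apply/eqP; rewrite eq_le N0 andbT leNgt; apply/negP=> Ngt0.
(* Any step t with 0 < t and t Q < 2 N would do; 1 + Q avoids dividing by 0. *)
have /= := psd (u - (N / (1 + Q)) *: w); rewrite quad.
apply/negP; rewrite -ltNge pmulr_rlt0 ?divr_gt0 //; last by lra.
have -> : N / (1 + Q) * Q = N * (Q / (1 + Q)) by rewrite mulrAC mulrA.
rewrite subr_lt0 [2 * N]mulrC ltr_pM2l // ltr_pdivrMr; lra.
Qed.

(** In the basis of the rows of [B] and [C] the matrix [A] becomes block
    diagonal with blocks [x%:M] and [E]. *)
Lemma char_poly_block (F : fieldType) n m r (A : 'M[F]_n) (B : 'M_(m, n))
    (C : 'M_(r, n)) (E : 'M_r) (x : F) : n = (m + r)%N ->
  row_free (col_mx B C) -> B *m A = x *: B -> C *m A = E *m C ->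
  char_poly A = ('X - x%:P) ^+ m * char_poly E.
Proof.
move=> nE; subst n => freeP BA CA.
set P := col_mx B C in freeP; set D := block_mx x%:M 0 0 E : 'M_(m + r).
have PA : P *m A = D *m P.
  by rewrite mul_col_mx BA CA mul_block_col !mul0mx add0r addr0 mul_scalar_mx.
have detP : \det (map_mx polyC P) != 0.
  rewrite det_map_mx polyC_eq0 -unitfE -[_ \is a _]/(P \in unitmx) -row_free_unit //.
apply: (mulIf detP); rewrite mulrC /char_poly -det_mulmx.
have -> : map_mx polyC P *m char_poly_mx A = char_poly_mx D *m map_mx polyC P.
  rewrite /char_poly_mx mulmxBr mulmxBl -!map_mxM PA; congr (_ - _).
  by rewrite scalar_mxC.
rewrite det_mulmx; congr (_ * _).
rewrite /char_poly_mx map_block_mx !map_mx0 map_scalar_mx scalar_mx_block.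
rewrite opp_block_mx add_block_mx !subr0 det_lblock -raddfB /=.
by rewrite det_scalar.
Qed.

(** For symmetric [A] the kernel and the image of [A - x%:M] are orthogonal,
    hence complementary, and both are stable under [A]; on the image [x] is no
    longer an eigenvalue. *)
Lemma mup_char_poly_sym (R : realFieldType) n (A : 'M[R]_n) (x : R) :
  A^T = A -> mup x (char_poly A) = \rank (kermx (A - x%:M)).
Proof.
move=> symA; set S := A - x%:M.
have symS : S^T = S by rewrite linearB /= symA tr_scalar_mx.
have ker_im (u : 'rV_n) (v : 'rV_n) : u = v *m S -> u *m S = 0 -> u = 0.
  move=> uE uS; apply: dot_eq0.
  by rewrite {1}uE -mulmxA -[S]symS -trmx_mul uS linear0 mulmx0 mxE.
set B := row_base (kermx S); set C := row_base S.
have nE : n = (\rank (kermx S) + \rank S)%N.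
  by rewrite mxrank_ker subnK // rank_leq_row.
have BS : B *m S = 0 by apply/sub_kermxP; rewrite eq_row_base.
have BA : B *m A = x *: B.
  by apply/eqP; rewrite -subr_eq0 -mul_mx_scalar -mulmxBr BS.
have [E CA] : exists E, C *m A = E *m C.
  apply/submxP; rewrite eq_row_base -[A](subrK x%:M) mulmxDr mul_mx_scalar.
  by rewrite addmx_sub ?submxMl ?scalemx_sub ?eq_row_base.
have CS m (v : 'M_(m, _)) : exists w, v *m C = w *m S.
  by apply/submxP; rewrite (submx_trans (submxMl _ _)) // eq_row_base.
have freeC : row_free C by exact: row_base_free.
have freeP : row_free (col_mx B C).
  apply: inj_row_free => v; rewrite -[v]hsubmxK mul_row_col.
  move: (lsubmx v) (rsubmx v) => a b /eqP ab0.
  have [w wE] := CS _ b.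
  have bC : b *m C = 0.
    apply: (ker_im _ w) => //; move: ab0; rewrite addrC addr_eq0 => /eqP->.
    by rewrite mulNmx -mulmxA BS mulmx0 oppr0.
  have aB : a *m B = 0 by move: ab0; rewrite bC addr0 => /eqP.
  have z0 k l (M : 'M[R]_(k, l)) (y : 'rV_k) : row_free M -> y *m M = 0 -> y = 0.
    by move=> fM yM; apply: (row_free_inj fM); rewrite yM mul0mx.
  by rewrite (z0 _ _ _ _ freeC bC) (z0 _ _ _ _ (row_base_free _) aB) row_mx0.
rewrite (char_poly_block nE freeP BA CA) mupMl.
  by rewrite mup_XsubCX eqxx.
rewrite -eigenvalue_root_char; apply/eigenvalueP=> -[v vE v0].
have [w wE] := CS _ v; case/negP: v0; apply/eqP.
apply: (row_free_inj freeC); rewrite mul0mx; apply: (ker_im _ w) => //.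
by rewrite /S mulmxBr -mulmxA CA mulmxA vE mul_mx_scalar scalemxAl subrr.
Qed.

(** * Rooted trees *)

Section Dist.
Variable G : sgraph.
Implicit Types (x y z : G) (p : seq G).

Lemma dist_le_size x p : path (@adj G) x p -> (dist x (last x p) <= size p)%N.
Proof.
move=> xp; rewrite leqNgt; apply/negP=> lt_find.
have ltG : (size p < #|G|)%N.
  by apply: leq_trans lt_find _; rewrite -[leqRHS](size_iota 0) find_size.
have /existsP[] := before_find 0%N lt_find.
by rewrite nth_iota //; exists (in_tuple p); rewrite /= xp eqxx.
Qed.

Lemma distxx x : dist x x = 0%N.
Proof. by apply/eqP; rewrite -leqn0 (@dist_le_size x [::]). Qed.

Hypothesis connG : connected G.

Lemma dist_path x y :
  exists2 p, path (@adj G) x p & last x p = y /\ size p = dist x y.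
Proof.
pose reach n := [exists p : n.-tuple G, path (@adj G) x p && (last x p == y)].
have hasP : has reach (iota 0 #|G|).
  have /connectP[p xp yE] := connG x y; rewrite /reach yE.
  case/shortenP: xp {yE} => q xq uq _; apply/hasP; exists (size q).
    by rewrite mem_iota /= add0n -[(size q).+1]/(size (x :: q)) -(card_uniqP uq) max_card.
  by apply/existsP; exists (in_tuple q); rewrite /= xq eqxx.
have := nth_find 0%N hasP; have := hasP; rewrite has_find size_iota => lt_find.
rewrite nth_iota // add0n => /existsP[p /andP[xp /eqP lp]].
by exists p => //; rewrite size_tuple.
Qed.

Lemma dist_eq0 x y : dist x y = 0%N -> x = y.
Proof. by have [[|z p] _ [<- <-]] := dist_path x y. Qed.

Lemma dist_adj x y z : adj y z -> (dist x z <= (dist x y).+1)%N.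
Proof.
have [p xp [lp <-]] := dist_path x y => yz.
by have := @dist_le_size x (rcons p z); rewrite rcons_path lp xp yz last_rcons size_rcons; apply.
Qed.

Lemma dist_pred x y : y != x -> exists2 z, adj y z & dist x y = (dist x z).+1.
Proof.
move=> yx; have [p xp [lp sp]] := dist_path x y.
case/lastP: p xp lp sp => [|p z]; first by move=> _ /= xy; rewrite xy eqxx in yx.
rewrite rcons_path last_rcons size_rcons => /andP[xp pz] zy sp; subst z.
exists (last x p); first by rewrite adj_sym.
by apply/eqP; rewrite eqn_leq dist_adj //= -sp ltnS dist_le_size.
Qed.
End Dist.

Section Tree.
Variables (G : sgraph) (r : G).
Hypothesis treeG : is_tree G.
Implicit Types (x y z : G) (p : seq G).

Let connG : connected G. Proof. by case: treeG. Qed.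
Let acycG : acyclic G. Proof. by case: treeG. Qed.
Local Notation dst := (dist r).

(** Descending along distances to [r] never meets [z] again, so every other
    vertex no farther than [z] reaches [r] in [G] minus [z]. *)
Lemma connect_lower z x : (dst x <= dst z)%N -> x != z ->
  connect (fun a b => [&& adj a b, a != z & b != z]) x r.
Proof.
have [n] := ubnP (dst x); elim: n x => // n IH x; rewrite ltnS => xn xz neq.
have [-> //|xr] := eqVneq x r.
have [y xy dE] := dist_pred connG xr.
have lt_yz : (dst y < dst z)%N by rewrite -dE.
have yz : y != z by apply: contraTneq lt_yz => ->; rewrite ltnn.
apply: connect_trans (IH y _ (ltnW lt_yz) yz); last by rewrite -dE.
by apply: connect1; rewrite xy neq yz.
Qed.

(** Two such neighbours would be joined by a path avoiding [z], which closes
    up through [z] to a cycle. Since equality of distances is allowed, this also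
    rules out edges between vertices at the same distance from [r]. *)
Lemma lower_nbr_uniq z x y : adj z x -> adj z y ->
  (dst x <= dst z)%N -> (dst y <= dst z)%N -> x = y.
Proof.
move=> zx zy xle yle; apply/eqP/negPn/negP=> xy.
have neq a : adj z a -> a != z by apply: contraTneq => ->; rewrite adj_irrefl.
pose e a b := [&& @adj G a b, a != z & b != z].
have avoid a s : path e a s -> z \notin s.
  elim: s a => //= b s IH a /andP[/and3P[_ _ bz] bs].
  by rewrite inE negb_or eq_sym bz (IH b).
have sym_e : connect_sym e.
  by apply: sym_connect_sym => a b; rewrite /e adj_sym andbCA andbC andbA.
have : connect e x y.
  apply: connect_trans (connect_lower xle (neq _ zx)) _.
  by rewrite sym_e connect_lower ?neq.
case/connectP=> p xp yE; move: xy zy yle; rewrite yE => {y yE}.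
case/shortenP: xp => q xq uq _ xy zy _.
have zq : z \notin x :: q.
  by rewrite inE negb_or eq_sym neq ?(avoid x).
have : ucycle (@adj G) (z :: x :: q).
  rewrite /ucycle [uniq _]cons_uniq zq uq andbT.
  rewrite /cycle rcons_path /= zx [adj _ z]adj_sym zy andbT.
  by rewrite (sub_path _ xq) // => a b /and3P[].
move/acycG; case: (q) xy => [|b q']; by [rewrite eqxx|].
Qed.

(** Junk value: [parent r = r]. *)
Definition parent x : G := odflt r [pick y | adj x y && (dst y < dst x)%N].

Lemma parentP x : x != r -> adj x (parent x) /\ dst x = (dst (parent x)).+1.
Proof.
move=> xr; rewrite /parent; case: pickP => [y /= /andP[xy lt_yx]|no_y].
  split=> //; have [z xz dE] := dist_pred connG xr.
  by rewrite (lower_nbr_uniq xy xz) // ?(ltnW lt_yx) // dE.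
by have [z xz dE] := dist_pred connG xr; have := no_y z; rewrite xz dE ltnSn.
Qed.

Lemma adj_parent x y :
  adj x y = (x != r) && (parent x == y) || (y != r) && (parent y == x).
Proof.
apply/idP/orP => [xy|[]/andP[/parentP[? _] /eqP<-]]; rewrite // 1?adj_sym //.
wlog le_yx : x y xy / (dst y <= dst x)%N.
  move=> IH; case/orP: (leq_total (dst y) (dst x)) => le; first exact: IH.
  by apply/or_comm; apply: IH => //; rewrite adj_sym.
have xr : x != r.
  apply: contraTneq le_yx => xr; rewrite xr distxx leqn0; apply/eqP=> /(dist_eq0 connG).
  by move=> yr; move: xy; rewrite xr -yr adj_irrefl.
have [xp dE] := parentP xr.
have e : parent x = y by apply: lower_nbr_uniq xp xy _ le_yx; rewrite dE.
by left; rewrite xr e eqxx.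
Qed.

Definition children x : {set G} := [set y | (y != r) && (parent y == x)].

Lemma parent_parent x : x != r -> parent x != r -> parent (parent x) != x.
Proof.
move=> /parentP[_ dx] /parentP[_ dp]; apply/eqP=> e; rewrite e in dp; lia.
Qed.

Lemma card_children x : #|children x| = (degree x - (x != r))%N.
Proof.
rewrite /degree; have [->|xr] := eqVneq x r.
  rewrite subn0; apply: eq_card => y; rewrite !inE adj_parent eqxx /=.
  by [].
have -> : [set y | adj x y] = parent x |: children x.
  by apply/setP=> y; rewrite !inE adj_parent xr /= eq_sym.
suff px : parent x \notin children x by rewrite cardsU1 px addKn.
rewrite inE negb_and negbK; case: eqVneq => //= pr.
exact: parent_parent.
Qed.

End Tree.

(** * The quadratic form of a line graph *)

Section LineGraph.
Variable G : sgraph.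
Implicit Types e f : line_graph G.

Lemma edgeP e : exists x y : G, adj x y /\ val e = [set x; y].
Proof.
have /existsP[x /existsP[y /andP[xy /eqP eE]]] := valP e.
by exists x, y.
Qed.

Lemma card_edge e : #|val e| = 2%N.
Proof.
have [x [y [xy ->]]] := edgeP e; rewrite cards2.
by have [xE|//] := eqVneq x y; rewrite xE adj_irrefl in xy.
Qed.

(** The entries of the adjacency matrix of [L(G)] plus twice the identity:
    distinct edges of a simple graph share at most one vertex. *)
Lemma card_edgeI e f : #|val e :&: val f| = (adj e f + (e == f).*2)%N.
Proof.
rewrite /= /line_adj; have [->|ef] /= := eqVneq e f; first by rewrite setIid card_edge.
have : (#|val e :&: val f| < 2)%N.
  rewrite ltnNge; apply: contraNN ef => le2; rewrite -val_eqE.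
  have /eqP <- : val e :&: val f == val e by rewrite eqEcard subsetIl card_edge.
  by rewrite eqEcard subsetIr card_edge.
by rewrite addn0 -card_gt0; case: #|_| => [|[]].
Qed.

(** This is the factorization [A(L(G)) + 2 I = N^T N] with [N] the incidence
    matrix of [G], read on quadratic forms. *)
Lemma line_graph_form (R : comPzRingType) (u : line_graph G -> R) :
  \sum_(e : line_graph G) \sum_(f : line_graph G) u e * (adj e f)%:R * u f + 2 * \sum_e u e ^+ 2 =
  \sum_(v : G) (\sum_(e : line_graph G | v \in val e) u e) ^+ 2.
Proof.
have sqE (v : G) : (\sum_(e : line_graph G | v \in val e) u e) ^+ 2 =
    \sum_(e : line_graph G) \sum_(f : line_graph G) u e * u f * ((v \in val e :&: val f))%:R.
  rewrite expr2 big_distrlr /= big_mkcond; apply: eq_bigr => e _.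
  rewrite big_mkcond (fun_if (fun x => x)); case: ifP => ve.
    by apply: eq_bigr => f _; rewrite inE ve /=; case: ifP; rewrite ?mulr1 ?mulr0.
  by rewrite big1 // => f _; rewrite inE ve mulr0.
rewrite (eq_bigr _ (fun v _ => sqE v)) [RHS]exchange_big mulr_sumr -big_split.
apply: eq_bigr => e _; rewrite [RHS]exchange_big.
have -> : 2 * u e ^+ 2 = \sum_f (e == f)%:R * (2 * u e * u f).
  rewrite (bigD1 e) //= eqxx mul1r big1 ?addr0 => [|f]; first by rewrite mulrA.
  by rewrite eq_sym => /negPf->; rewrite mul0r.
rewrite -[LHS]big_split; apply: eq_bigr => f _; rewrite -mulr_sumr.
rewrite -natr_sum -big_mkcond sum1_card.
rewrite card_edgeI natrD -mul2n natrM; move: (adj e f) => a /=; ring.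
Qed.

Lemma adjmx_form (R : rcfType) (u : 'rV[R]_#|line_graph G|) :
  (u *m adjmx R (line_graph G) *m u^T) 0 0 =
  \sum_(e : line_graph G) \sum_(f : line_graph G) u 0 (enum_rank e) * (adj e f)%:R * u 0 (enum_rank f).
Proof.
rewrite mxE [RHS]exchange_big (reindex _ (onW_bij _ (@enum_rank_bij _))).
apply: eq_bigr => f _; rewrite !mxE big_distrl (reindex _ (onW_bij _ (@enum_rank_bij _))).
by apply: eq_bigr => e _; rewrite mxE !enum_rankK.
Qed.

Lemma dot_enum (R : rcfType) (u : 'rV[R]_#|line_graph G|) :
  (u *m u^T) 0 0 = \sum_e u 0 (enum_rank e) ^+ 2.
Proof.
rewrite mxE (reindex _ (onW_bij _ (@enum_rank_bij _))); by apply: eq_bigr => e _; rewrite mxE.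
Qed.

Lemma adjmx_sym (R : rcfType) : (adjmx R (line_graph G))^T = adjmx R (line_graph G).
Proof. by apply/matrixP=> i j; rewrite !mxE adj_sym. Qed.

End LineGraph.

Section TreeEdges.
Variables (G : sgraph) (r : G).
Hypothesis treeG : is_tree G.
Implicit Types (e f : line_graph G) (v x y : G).
Local Notation parent := (parent r).

(** In a rooted tree the edges correspond to the non-root vertices, an edge
    being sent to its endpoint farther from the root. *)
Definition lower e : G :=
  odflt r [pick v | (v != r) && (val e == [set v; parent v])].

Lemma lowerP e : lower e != r /\ val e = [set lower e; parent (lower e)].
Proof.
rewrite /lower; case: pickP => [v /andP[vr /eqP]|none] //=.
have [x [y [xy eE]]] := edgeP e.
move: xy; rewrite (adj_parent r treeG) => /orP[]/andP[zr /eqP pz].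
  by have := none x; rewrite zr eE pz eqxx.
by have := none y; rewrite zr eE pz setUC eqxx.
Qed.

Lemma lower_inj : injective lower.
Proof.
move=> e f ef; apply: val_inj.
by have [_ ->] := lowerP e; have [_ ->] := lowerP f; rewrite ef.
Qed.

Lemma lower_surj v : v != r -> exists e, lower e = v.
Proof.
move=> vr; have edge_v : is_edge [set v; parent v].
  apply/existsP; exists v; apply/existsP; exists (parent v).
  by rewrite (parentP treeG vr).1 eqxx.
pose e : line_graph G := Sub _ edge_v; exists e.
have [wr] := lowerP e; rewrite SubK => vw.
have := set21 v (parent v); rewrite vw !inE => /orP[/eqP-> //|/eqP vE].
have := set21 (lower e) (parent (lower e)); rewrite -vw !inE => /orP[/eqP-> //|/eqP wE].
have := parent_parent treeG wr; rewrite -vE -wE eqxx.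
by move/(_ vr).
Qed.

Lemma sum_lower (V : nmodType) (F : G -> V) :
  \sum_e F (lower e) = \sum_(v | v != r) F v.
Proof.
rewrite (partition_big lower (fun v => v != r)) => [|e _]; last by case: (lowerP e).
apply: eq_bigr => v /lower_surj[e eE]; rewrite (big_pred1 e) ?eE //= => f.
by rewrite -eE (inj_eq lower_inj).
Qed.

Section Lift.
Variables (R : comPzRingType) (u : line_graph G -> R).

(** The sum has at most one term, the value of [u] on the edge joining [v] to
    its parent, and is empty at the root. *)
Definition above v : R := \sum_(e | lower e == v) u e.

Lemma above_root : above r = 0.
Proof. by rewrite /above big1 // => e; case: (lowerP e) => /negPf->. Qed.

Lemma above_lower e : above (lower e) = u e.
Proof. by rewrite /above (big_pred1 e) // => f; rewrite /= (inj_eq lower_inj). Qed.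

Lemma sum_incident v : \sum_(e : line_graph G | v \in val e) u e =
  above v + \sum_(c in children r v) above c.
Proof.
have vE e : (v \in val e) = (lower e == v) || (parent (lower e) == v).
  by have [_ ->] := lowerP e; rewrite !inE ![_ == v]eq_sym.
rewrite (bigID (fun e => lower e == v)) /=; congr (_ + _).
  by apply: eq_bigl => e; rewrite vE; case: eqP; rewrite ?andbF.
rewrite (eq_bigl (fun c => (c != r) && (parent c == v))) => [|c]; last by rewrite inE.
rewrite [RHS]big_mkcondr -sum_lower.
rewrite -[RHS]big_mkcond; apply: eq_big => [e|e _].
  rewrite vE; have [<-|//] := eqVneq (lower e) v; last by rewrite andbT.
  rewrite andbF; apply/esym/eqP=> pE; have [er _] := lowerP e.
  by have := (parentP treeG er).1; rewrite pE adj_irrefl.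
by rewrite above_lower.
Qed.

End Lift.

Lemma adjmx_tree_form (R : rcfType) (lam : R) (u : 'rV[R]_#|line_graph G|) :
  let y := above (fun e => u 0 (enum_rank e)) in
  (u *m (adjmx R (line_graph G) - lam%:M) *m u^T) 0 0 =
  \sum_v (y v + \sum_(c in children r v) y c) ^+ 2
  - (lam + 2) * \sum_(v | v != r) y v ^+ 2.
Proof.
move=> y; rewrite mulmxBr mulmxBl mul_mx_scalar -scalemxAl.
have entB (X Y : 'M[R]_1) : (X - lam *: Y) 0 0 = X 0 0 - lam * Y 0 0 by rewrite !mxE.
rewrite entB adjmx_form dot_enum.
have sqE : \sum_(v | v != r) y v ^+ 2 = \sum_e u 0 (enum_rank e) ^+ 2.
  by rewrite -sum_lower; apply: eq_bigr => e _; rewrite /y above_lower.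
rewrite sqE -(eq_bigr _ (fun v _ => congr1 (fun t => t ^+ 2) (sum_incident _ v))).
by rewrite -line_graph_form; ring.
Qed.

End TreeEdges.

(** * Sums of squares on a Bethe tree *)

(** Completing squares at one vertex: [x] is the value on the edge above it,
    the [y c] those on the edges below it, and [p / q] the weight already
    obtained for each of the latter. For fixed [x] and positive [p], [q] the
    minimum is reached when every [y c] equals [- x t], and it is
    [(p - mu q') / q'] times [x ^+ 2]. *)
Lemma star_sos (R : fieldType) (T : finType) (A : {set T}) (y : T -> R)
    (x mu p q : R) : let q' := p + #|A|%:R * q in let t := q / q' in
    q != 0 -> q' != 0 ->
  (x + \sum_(c in A) y c) ^+ 2 - mu * x ^+ 2 =
  (p - mu * q') / q' * x ^+ 2 - p / q * \sum_(c in A) y c ^+ 2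
  + (p / q * \sum_(c in A) (y c + x * t) ^+ 2
     + (\sum_(c in A) y c + #|A|%:R * (x * t)) ^+ 2).
Proof.
move=> q' t q0 q'0.
have -> : \sum_(c in A) (y c + x * t) ^+ 2 = \sum_(c in A) y c ^+ 2
    + 2 * (x * t) * (\sum_(c in A) y c) + #|A|%:R * (x * t) ^+ 2.
  rewrite (eq_bigr (fun c => y c ^+ 2 + 2 * (x * t) * y c + (x * t) ^+ 2)).
    by rewrite !big_split /= sumr_const mulr_sumr [_%:R * _ ^+ 2]mulr_natl.
  by move=> c _; ring.
rewrite /t; move: (\sum_(c in A) y c ^+ 2) (\sum_(c in A) y c) => s2 s1.
rewrite /q' in q'0 *; move: (#|A|%:R : R) q'0 => m q'0.
by field; rewrite q0 q'0.
Qed.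

Section Bethe.
Variables (k : nat) (d : nat -> nat) (G : sgraph) (r : G).
Hypothesis hG : is_bethe_tree r k d.

Let treeG : is_tree G. Proof. by case: hG. Qed.
Local Notation ht v := (k - dist r v)%N.
Local Notation par := (parent r).
Local Notation ch := (children r).

Lemma degree_ht v : degree v = d (ht v).
Proof.
have [_ lev _ ->] := hG; have := lev v; rewrite /level => le.
by congr d; lia.
Qed.

Lemma ht_gt0 v : (0 < ht v)%N.
Proof. by have [_ lev _ _] := hG; have := lev v; rewrite /level subn_gt0. Qed.

Lemma dist_child v c : c \in ch v -> dist r c = (dist r v).+1.
Proof. by rewrite inE => /andP[/(parentP treeG)[_ ->] /eqP->]. Qed.

Lemma ht_child v c : c \in ch v -> (ht v = (ht c).+1)%N.
Proof. by move=> cv; have := ht_gt0 c; rewrite (dist_child cv); lia. Qed.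

Lemma dist_gt0 v : v != r -> (0 < dist r v)%N.
Proof. by move=> /(parentP treeG)[_ ->]. Qed.

Lemma ht_lt v : v != r -> (ht v < k)%N.
Proof. by move=> /dist_gt0; have := ht_gt0 v; lia. Qed.

Lemma card_ch_root : #|ch r| = d k.
Proof.
by rewrite (card_children r treeG) degree_ht eqxx distxx !subn0.
Qed.

(** A branch at the root is represented by its vertex nearest to the root. *)
Definition branch v := iter (dist r v).-1 par v.

Lemma branch_root_child c : c \in ch r -> branch c = c.
Proof. by move=> /dist_child; rewrite /branch distxx => ->. Qed.

Lemma branch_child v c : v != r -> c \in ch v -> branch c = branch v.
Proof.
move=> vr cv; rewrite /branch (dist_child cv) /=; have := dist_gt0 vr.
case: (dist r v) => // n _; rewrite iterSr /=.
by move: cv; rewrite inE => /andP[_ /eqP->].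
Qed.

Lemma in_ch_parent v : v != r -> v \in ch (par v).
Proof. by move=> vr; rewrite inE vr eqxx. Qed.

Lemma branch_in v : v != r -> branch v \in ch r.
Proof.
have [n] := ubnP (dist r v); elim: n v => // n IH v; rewrite ltnS => vn vr.
have vp := in_ch_parent vr; have [pr|pr] := eqVneq (par v) r.
  by rewrite pr in vp; rewrite branch_root_child.
by rewrite (branch_child pr vp) IH // -(dist_child vp).
Qed.

Variables (R : rcfType) (mu : R).
Hypothesis d1 : d 1%N = 1%N.
Hypothesis hd : forall i : nat, (2 <= i <= k)%N -> (2 <= d i)%N.

Lemma card_ch v : v != r -> (#|ch v|%:R = (d (ht v))%:R - 1 :> R).
Proof.
move=> vr; rewrite (card_children r treeG) degree_ht vr natrB //.
have := ht_gt0 v; have := ht_lt vr; case: (ht v) => [|[|i]] // ik _.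
  by rewrite d1.
by apply/ltnW/hd; rewrite /= ltnW.
Qed.

Local Notation num := (rnum d mu).
Local Notation den := (rden d mu).
Hypothesis num_gt0 : forall i, (i < k.-1)%N -> 0 < num i.
Hypothesis num_last : num k.-1 = 0.

Lemma den_gt0 i : (i < k)%N -> 0 < den i.
Proof.
move=> ik; apply: (rden_gt0 _ num_gt0); last by lia.
case=> [|[|j]] // jk; first by rewrite d1.
by apply/ltnW/hd; lia.
Qed.

(** Minus the ratio of the minimizing values on an edge below [v] and on the
    edge above [v]. *)
Definition slope v : R := den (ht v).-1 / den (ht v).

(** The minimum, on the edge above [v] and the subtree below [v], of the
    shifted form, when the value on that edge is 1. *)
Definition weight v : R := num (ht v) / den (ht v).

Lemma weight_child v c : v != r -> c \in ch v -> 0 < weight c.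
Proof.
move=> vr cv; have := ht_lt vr; rewrite (ht_child cv) => lt.
by rewrite divr_gt0 ?den_gt0 ?num_gt0 //; lia.
Qed.

Lemma weight_root_child c : c \in ch r -> weight c = 0.
Proof.
move=> cr; rewrite /weight; have := ht_child cr; rewrite distxx subn0.
move=> kE; have -> : ht c = k.-1 by lia.
by rewrite num_last mul0r.
Qed.

Variable y : G -> R.
Hypothesis yr : y r = 0.
Definition chsum v : R := \sum_(c in ch v) y c.

(** The excess of the form over its minimum that is caused at [v]. *)
Definition defect v : R :=
  \sum_(c in ch v) weight c * (y c + y v * slope v) ^+ 2
  + (chsum v + #|ch v|%:R * (y v * slope v)) ^+ 2.

Lemma node_sos v : v != r ->
  (y v + chsum v) ^+ 2 - mu * y v ^+ 2 =
  weight v * y v ^+ 2 - \sum_(c in ch v) weight c * y c ^+ 2 + defect v.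
Proof.
move=> vr; have := ht_gt0 v; case htE : (ht v) => [//|j] _.
have jk : (j.+1 < k)%N by rewrite -htE ht_lt.
have wE c : c \in ch v -> weight c = num j / den j.
  by move=> /ht_child; rewrite htE => -[jE]; rewrite /weight -jE.
have := @star_sos R G (ch v) y (y v) mu (num j) (den j).
rewrite /= card_ch // htE -rdenS -rnumS => ->; last 2 first.
- by rewrite gt_eqF // den_gt0 // ltnW.
- by rewrite gt_eqF // den_gt0.
rewrite /defect /slope /weight htE /= card_ch // htE !mulr_sumr.
by congr (_ - _ + (_ + _)); apply: eq_bigr => c /wE <-.
Qed.

(** Summing the local identities over all non-root vertices, every weighted
    square but those at the children of the root appears once with each sign;
    the remaining ones have weight 0 because [num k.-1 = 0]. *)
Lemma tree_sos :
  \sum_v (y v + chsum v) ^+ 2 - mu * \sum_(v | v != r) y v ^+ 2 =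
  chsum r ^+ 2 + \sum_(v | v != r) defect v.
Proof.
rewrite (bigD1 r) //= yr add0r -addrA; congr (_ + _).
rewrite mulr_sumr -sumrB (eq_bigr _ node_sos) big_split /= sumrB.
rewrite -[RHS]add0r; congr (_ + _); apply/eqP; rewrite subr_eq0; apply/eqP.
rewrite (partition_big par predT) //= (bigD1 r) //= big1 ?add0r => [|c cr]; last first.
  by rewrite weight_root_child ?mul0r // inE.
by apply: eq_bigr => v vr; apply: eq_bigl => c; rewrite inE.
Qed.

Lemma defect_ge0 v : v != r -> 0 <= defect v.
Proof.
move=> vr; rewrite addr_ge0 ?sqr_ge0 // sumr_ge0 // => c cv.
by rewrite mulr_ge0 ?sqr_ge0 // ltW // (weight_child vr cv).
Qed.

Lemma defect_eq0 v : v != r ->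
  defect v = 0 <-> forall c, c \in ch v -> y c = - (y v * slope v).
Proof.
move=> vr; split=> [/eqP|yE].
  rewrite paddr_eq0 ?sqr_ge0 ?sumr_ge0 // => [/andP[]|c cv]; last first.
    by rewrite mulr_ge0 ?sqr_ge0 // ltW // (weight_child vr cv).
  rewrite psumr_eq0 => [/allP all0 _ c cv|c cv]; last first.
    by rewrite mulr_ge0 ?sqr_ge0 // ltW // (weight_child vr cv).
  have := all0 c (mem_index_enum c); rewrite cv /= mulf_eq0 sqrf_eq0.
  by rewrite gt_eqF ?(weight_child vr cv) //= addr_eq0 => /eqP.
rewrite /defect /chsum big1 => [|c /yE->]; last by rewrite addNr expr0n mulr0.
by rewrite (eq_bigr _ yE) sumr_const mulr_natl mulNrn addNr expr0n addr0.
Qed.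

Lemma tree_form_ge0 :
  0 <= \sum_v (y v + chsum v) ^+ 2 - mu * \sum_(v | v != r) y v ^+ 2.
Proof. by rewrite tree_sos addr_ge0 ?sqr_ge0 ?sumr_ge0 //; exact: defect_ge0. Qed.

(** The values, along a branch and up to scaling, at which all defects of
    the branch vanish. *)
Definition profile v : R := (-1) ^+ ht v * den (ht v).

Lemma profile_neq0 v : v != r -> profile v != 0.
Proof. by move=> vr; rewrite mulf_neq0 ?signr_eq0 // gt_eqF // den_gt0 // ht_lt. Qed.

Lemma profile_child v c : v != r -> c \in ch v -> profile c = - (profile v * slope v).
Proof.
move=> vr cv; rewrite /profile /slope (ht_child cv) /= exprS.
have : den (ht c).+1 != 0 by rewrite -(ht_child cv) gt_eqF // den_gt0 // ht_lt.
by move=> h; field.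
Qed.

Lemma profile_root_child c c' : c \in ch r -> c' \in ch r -> profile c = profile c'.
Proof. by move=> /dist_child cE /dist_child cE'; rewrite /profile cE cE'. Qed.

(** On each branch at the root the values are forced by the value on its top
    edge, and the only other condition is that the top values sum to 0. *)
Lemma tree_form_eq0 :
  \sum_v (y v + chsum v) ^+ 2 - mu * \sum_(v | v != r) y v ^+ 2 = 0 <->
  exists2 z : G -> R, \sum_(c in ch r) z c = 0 &
    forall v, v != r -> y v = profile v * z (branch v).
Proof.
rewrite tree_sos; split=> [/eqP|[z z0 yE]].
  have sum_ge0 : 0 <= \sum_(v | v != r) defect v by apply: sumr_ge0; exact: defect_ge0.
  rewrite paddr_eq0 ?sqr_ge0 // sqrf_eq0 [X in _ && X]psumr_eq0; last exact: defect_ge0.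
  move=> /andP[/eqP root0 /allP all0].
  have slopeE v c : v != r -> c \in ch v -> y c = - (y v * slope v).
    move=> vr; move: c; apply/(defect_eq0 vr)/eqP.
    by have := all0 v (mem_index_enum v); rewrite vr.
  exists (fun c => y c / profile c).
    case: (pickP (mem (ch r))) => [c0 c0r|none]; last by rewrite big_pred0.
    rewrite (eq_bigr (fun c => y c / profile c0)); last first.
      by move=> c cr; rewrite (profile_root_child cr c0r).
    by rewrite -mulr_suml -/(chsum r) root0 mul0r.
  move=> v; have [n] := ubnP (dist r v); elim: n v => // n IH v; rewrite ltnS => vn vr.
  have vp := in_ch_parent vr; have [pr|pr] := eqVneq (par v) r.
    rewrite pr in vp; rewrite branch_root_child // mulrC divfK //; exact: profile_neq0.
  rewrite (slopeE _ _ pr vp) IH // -?(dist_child vp) // (branch_child pr vp).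
  by rewrite (profile_child pr vp); ring.
have -> : chsum r = 0.
  rewrite /chsum; case: (pickP (mem (ch r))) => [c0 c0r|none]; last by rewrite big_pred0.
  rewrite (eq_bigr (fun c => profile c0 * z c)) -?mulr_sumr ?z0 ?mulr0 // => c cr.
  rewrite yE ?branch_root_child // ?(profile_root_child cr c0r) //.
  by move: cr; rewrite inE => /andP[].
rewrite expr0n add0r big1 // => v vr; apply/(defect_eq0 vr) => c cv.
rewrite !yE // ?(profile_child vr cv) ?(branch_child vr cv); first by ring.
by move: cv; rewrite inE => /andP[].
Qed.

End Bethe.

(** * The eigenspace *)

Section Kernel.
Variables (R : rcfType) (k : nat) (d : nat -> nat) (G : sgraph) (r : G).
Variable (lam : R).
Hypotheses (hk : (2 <= k)%N) (d1 : d 1%N = 1%N).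
Hypothesis hd : forall i : nat, (2 <= i <= k)%N -> (2 <= d i)%N.
Hypothesis hG : is_bethe_tree r k d.
Local Notation mu := (lam + 2).
Hypothesis num_gt0 : forall i, (i < k.-1)%N -> 0 < rnum d mu i.
Hypothesis num_last : rnum d mu k.-1 = 0.

Let treeG : is_tree G. Proof. by case: hG. Qed.
Local Notation ch := (children r r).
Local Notation A := (adjmx R (line_graph G)).
Local Notation S := (A - lam%:M).
Local Notation val_above u := (above r (fun e => u 0 (enum_rank e))).

Lemma shifted_sym : S^T = S.
Proof. by rewrite linearB /= adjmx_sym tr_scalar_mx. Qed.

Lemma shifted_ge0 (u : 'rV_#|line_graph G|) : 0 <= (u *m S *m u^T) 0 0.
Proof.
rewrite (adjmx_tree_form r treeG).
exact: (tree_form_ge0 hG d1 hd num_gt0 num_last (above_root _ treeG _)).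
Qed.

Lemma shifted_kerP (u : 'rV_#|line_graph G|) : u *m S = 0 <->
  exists2 z : G -> R, \sum_(c in ch) z c = 0 &
    forall e, u 0 (enum_rank e) =
      profile k d r mu (lower r e) * z (branch r (lower r e)).
Proof.
have eq0P := tree_form_eq0 hG d1 hd num_gt0 num_last
  (above_root r treeG (fun e => u 0 (enum_rank e))).
split=> [uS|[z z0 uE]].
  have [|z z0 yE] := eq0P.1; first by rewrite -adjmx_tree_form // uS mul0mx mxE.
  exists z => // e; rewrite -yE ?(above_lower r treeG) //.
  by case: (lowerP r treeG e).
apply: psd_ker shifted_sym shifted_ge0 _.
rewrite (adjmx_tree_form r treeG); apply/eq0P; exists z => // v vr.
by have [e <-] := lower_surj treeG vr; rewrite above_lower.
Qed.

(** Row [i] is the profile on the branch of the [i]-th child of the root and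
    vanishes elsewhere. *)
Definition branch_mx : 'M[R]_(#|ch|, #|line_graph G|) :=
  \matrix_(i, j) (let v := lower r (enum_val j) in
    profile k d r mu v * (branch r v == enum_val i)%:R).

Definition branch_val (z : 'rV[R]_#|ch|) (c : G) : R :=
  \sum_i z 0 i * (c == enum_val i)%:R.

Lemma branch_val_enum z i : branch_val z (enum_val i) = z 0 i.
Proof.
rewrite /branch_val (bigD1 i) //= eqxx mulr1 big1 ?addr0 // => j ji.
by rewrite (inj_eq enum_val_inj) eq_sym (negPf ji) mulr0.
Qed.

Lemma mul_branch_mx z e : (z *m branch_mx) 0 (enum_rank e) =
  profile k d r mu (lower r e) * branch_val z (branch r (lower r e)).
Proof.
rewrite mxE mulr_sumr; apply: eq_bigr => i _.
by rewrite mxE enum_rankK mulrCA.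
Qed.

Lemma branch_mx_free : row_free branch_mx.
Proof.
apply: inj_row_free => z zK; apply/rowP=> i; rewrite mxE.
have chi := enum_valP i; have cr : enum_val i != r by move: chi; rewrite inE => /andP[].
have [e eE] := lower_surj treeG cr.
have := mul_branch_mx z e; rewrite zK eE (branch_root_child hG chi) branch_val_enum mxE.
by move/esym/eqP; rewrite mulf_eq0 (negPf (profile_neq0 hG d1 hd num_gt0 cr)) => /eqP.
Qed.

Local Notation ones := (const_mx 1 : 'cV[R]_#|ch|).

Lemma mul_ones (z : 'rV[R]_#|ch|) : (z *m ones) 0 0 = \sum_(c in ch) branch_val z c.
Proof.
rewrite mxE [RHS]big_enum_val; apply: eq_bigr => i _.
by rewrite mxE mulr1 branch_val_enum.
Qed.

Lemma shifted_ker : (kermx S :=: kermx ones *m branch_mx)%MS.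
Proof.
apply/eqmxP/andP; split; apply/row_subP=> i.
  set u := row i _; have uS : u *m S = 0.
    by rewrite /u -row_mul mulmx_ker row0.
  have [z z0 uE] := (shifted_kerP u).1 uS.
  pose w : 'rV[R]_#|ch| := \row_i z (enum_val i).
  have wE c : c \in ch -> branch_val w c = z c.
    by move=> cr; rewrite -(enum_rankK_in cr cr) branch_val_enum mxE.
  have -> : u = w *m branch_mx.
    apply/rowP=> j; rewrite -(enum_valK j) mul_branch_mx uE wE //.
    by apply: (branch_in hG); case: (lowerP r treeG (enum_val j)).
  apply/submxMr/sub_kermxP/rowP=> j; rewrite !ord1 mul_ones mxE.
  by rewrite (eq_bigr _ wE).
apply/sub_kermxP; rewrite row_mul; set z := row i _.
have zo : z *m ones = 0 by rewrite /z -row_mul mulmx_ker row0.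
apply/shifted_kerP; exists (branch_val z); first by rewrite -mul_ones zo mxE.
exact: mul_branch_mx.
Qed.

(** The kernel is as large as the space of the vectors of values on the edges
    at the root, which is the hyperplane of sum 0 in dimension [d k]. *)
Lemma rank_shifted_ker : \rank (kermx S) = (d k - 1)%N.
Proof.
rewrite shifted_ker (mxrankMfree _ branch_mx_free) mxrank_ker.
rewrite -(card_ch_root hG); congr (_ - _)%N.
apply/eqP; rewrite eqn_leq rank_leq_col lt0n mxrank_eq0.
have /card_gt0P[c cr] : (0 < #|ch|)%N.
  by rewrite (card_ch_root hG); apply/ltnW/hd; rewrite hk /=.
apply/eqP=> /matrixP/(_ (enum_rank_in cr c) 0); rewrite !mxE => /eqP.
by rewrite oner_eq0.
Qed.

Lemma smallest_eigenvalue_line_graph : smallest_eigenvalue (line_graph G) lam.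
Proof.
split.
  rewrite /eigenvalue /eigenspace -mxrank_eq0 rank_shifted_ker.
  by have := hd (i := k); rewrite hk leqnn => /(_ isT); lia.
move=> y /eigenvalueP[u uE u0]; rewrite -subr_ge0.
have := shifted_ge0 u; rewrite mulmxBr uE mul_mx_scalar -scalerBl -scalemxAl mxE.
rewrite pmulr_lge0 // lt_def dot_ge0 andbT.
by apply: contraNneq u0 => /dot_eq0->.
Qed.

End Kernel.

(** * The smallest eigenvalue *)

Theorem theorem12 (R : rcfType) (k : nat) (d : nat -> nat)
    (G : sgraph) (r : G)
    (hk : (2 <= k)%N)
    (hd1 : d 1%N = 1%N)
    (hd : forall i : nat, (2 <= i <= k)%N -> (2 <= d i)%N)
    (hG : is_bethe_tree r k d) :
  exists lam : R,
    [/\ smallest_eigenvalue (line_graph G) lam,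
        smallest_zero (gpoly R k d k.-1) lam,
        ~~ root (gpoly R k d k %/ ('X + 2)) lam,
        forall i : nat, (1 <= i <= k - 2)%N -> ~~ root (gpoly R k d i) lam
      & eigenvalue_mult (line_graph G) lam = (d k - 1)%N].
Proof.
have [j kE] : exists j, k = j.+2 by exists k.-2; lia.
have d_lt i : (2 <= i < k)%N -> (2 <= d i)%N.
  by move=> /andP[i2 ik]; rewrite hd // i2 ltnW.
have jk : (j.+1 < k)%N by rewrite kE.
have [mu [_ mu0 mu_gt0 mu_low]] := first_zero R hd1 jk d_lt.
have muE : mu - 2 + 2 = mu by rewrite subrK.
have gE i x : (i < k)%N -> root (gpoly R k d i) x = (rnum d (x + 2) i == 0).
  by move=> ik; rewrite /root (gpoly_rnum hd1 _ ik) mulf_eq0 signr_eq0.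
have num_gt0 i : (i < k.-1)%N -> 0 < rnum d (mu - 2 + 2) i.
  by rewrite muE kE; apply: mu_gt0.
have num_last : rnum d (mu - 2 + 2) k.-1 = 0 by rewrite muE kE.
exists (mu - 2); split.
- exact: smallest_eigenvalue_line_graph hG num_gt0 num_last.
- split=> [|y]; first by rewrite gE ?num_last //; lia.
  rewrite gE => [/eqP y0|]; last by lia.
  rewrite lerBlDr leNgt; apply/negP=> y_lt.
  by have := mu_low _ j.+1 y_lt (leqnn _); rewrite kE in y0; rewrite y0 ltxx.
- (* At a zero of g_{k-1} the recursion leaves g_k = - d_k g_{k-2}, which is
     not 0. *)
  apply/negP=> root_q.
  have : root (gpoly R k d k) (mu - 2).
    by rewrite -(divpK (dvdp_gpoly_last R d hk)) rootM root_q.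
  rewrite kE gpolySS eqxx /root !(horner_natr, hornerD, hornerN, hornerM) -kE.
  rewrite !gpoly_rnum -?kE ?muE ?mu0 //; last by rewrite kE.
  rewrite !mulr0 sub0r oppr_eq0 !mulf_eq0 signr_eq0 pnatr_eq0 (gt_eqF (mu_gt0 _ _)) // orbF.
  by have := hd k; rewrite hk leqnn => /(_ isT); case: (d k).
- move=> i ik; rewrite gE; last by lia.
  by rewrite gt_eqF // num_gt0; lia.
- rewrite /eigenvalue_mult mup_char_poly_sym ?adjmx_sym //.
  exact: rank_shifted_ker hG num_gt0 num_last.
Qed.
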